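(* Let $\{\mathcal{V}_n\mid n<\omega\}$ be an ascending chain of group varieties, let $\mathcal{V}=\bigcup_{n<\omega}\mathcal{V}_n$, and let $\lambda$ be a cardinal such that $\lambda=\lambda^{<\lambda}$. Then there exists an epi-universal group in the class $\mathcal{LV}_\lambda$ of all $\mathcal{LV}$-groups of cardinality $\le\lambda$.
   Context: Ascending means $\mathcal{V}_n\subseteq\mathcal{V}_{n+1}$ for all $n<\omega$; each $\mathcal{V}_n$ is generated (defined) by a set $E_n$ of identities, where it is assumed that $E_n\supseteq E_{n+1}$. A group $G$ is an $\mathcal{LV}$-group (a $\mathcal{V}$-locally group) if every finitely generated subgroup of $G$ belongs to $\mathcal{V}$; $\mathcal{LV}$ is the class of all such groups. For a class $\mathcal{K}$ of groups, $\mathcal{K}_\lambda$ is the subclass of all members of $\mathcal{K}$ of cardinality at most $\lambda$, and a group $G\in\mathcal{K}$ with $|G|=\lambda$ is called epi-universal in $\mathcal{K}_\lambda$ if every group in $\mathcal{K}_\lambda$ is an epimorphic image of $G$ (i.e. the image of $G$ under a surjective group homomorphism). Here this is applied with $\mathcal{K}=\mathcal{LV}$. As usual, $\lambda^{<\lambda}=\sup\{\lambda^{\mu}\mid\mu<\lambda\text{ a cardinal}\}$.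
   Formalization: It is additionally assumed that λ is nonzero and that, if λ > 1, the class LV_λ contains a nontrivial group; otherwise (e.g. all V_n trivial and λ infinite) no LV-group of cardinality λ exists and the claim fails. *)

(* Defs.v *)
From HB Require Import structures.
From mathcomp Require Import all_boot.
From mathcomp Require Import boolp classical_sets functions cardinality.

Set Implicit Arguments.
Unset Strict Implicit.
Unset Printing Implicit Defensive.

Local Open Scope classical_set_scope.
Local Open Scope card_scope.
Local Open Scope group_scope.

(* Groups are [groupType]s, finite or infinite. The underlying choice structure
   is no restriction: by [boolp], every type carries one. *)
Definition group_class := groupType -> Prop.

Inductive gterm :=
| GVar of nat
| GOne
| GMul of gterm & gterm
| GInv of gterm.

Fixpoint geval (G : groupType) (e : nat -> G) (t : gterm) : G :=
  match t with
  | GVar i => e i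
  | GOne => 1
  | GMul t1 t2 => geval e t1 * geval e t2
  | GInv t1 => (geval e t1)^-1
  end.

(* The pair (u, v) is the identity u = v. *)
Definition identity := (gterm * gterm)%type.

Definition satisfies (G : groupType) (w : identity) : Prop :=
  forall e : nat -> G, geval e w.1 = geval e w.2.

Definition is_variety (V : group_class) : Prop :=
  exists E : set identity,
    forall G : groupType, V G <-> (forall w, E w -> satisfies G w).

Definition ascending (V : nat -> group_class) : Prop :=
  forall n (G : groupType), V n G -> V n.+1 G.

Definition union_class (V : nat -> group_class) : group_class :=
  fun G => exists n, V n G.

Definition generated (G : groupType) (s : seq G) : {pred G} :=
  [pred x | `[< forall K : {pred G},
                  group_closed K -> {subset s <= K} -> x \in K >]].

Lemma generated_group_closed (G : groupType) (s : seq G) :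
  group_closed (generated s).
Proof.
split; first by apply/asboolP => K [].
move=> x y /asboolP sx /asboolP sy; apply/asboolP => K cK sK.
by apply: cK.2; [exact: sx | exact: sy].
Qed.

Definition fg_subgroup (G : groupType) (s : seq G) := {x : G | x \in generated s}.

HB.instance Definition _ (G : groupType) (s : seq G) :=
  SubChoice.on (fg_subgroup s).
HB.instance Definition _ (G : groupType) (s : seq G) :=
  SubChoice_isSubGroup.Build G (generated s) (fg_subgroup s)
    (generated_group_closed s).

Definition locally (V : group_class) : group_class :=
  fun G => forall s : seq G, V (fg_subgroup s).

(* A type stands for its cardinality. The named constant keeps all cardinals
   in one universe, so that a quantifier over the cardinals below [L] is not
   confined to a smaller universe than that of [L]. *)
Definition cardinal := Type.

Definition card_lt (M L : cardinal) : Prop :=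
  ([set: M] #<= [set: L]) /\ ~ ([set: L] #<= [set: M]).

(* L = L^{<L}: L is the least upper bound of the L^M with M < L. *)
Definition eq_pow_lt_self (L : cardinal) : Prop :=
  (forall M : cardinal, card_lt M L -> [set: M -> L] #<= [set: L]) /\
  (forall K : cardinal,
     (forall M : cardinal, card_lt M L -> [set: M -> L] #<= [set: K]) ->
     [set: L] #<= [set: K]).

Definition card_bounded (K : group_class) (L : cardinal) : group_class :=
  fun G => K G /\ [set: G] #<= [set: L].

Definition epi_universal (K : group_class) (L : cardinal) (G : groupType) : Prop :=
  [/\ K G, [set: G] #= [set: L]
    & forall H : groupType, card_bounded K L H ->
        exists f : {multiplicative G -> H}, set_surj [set: G] [set: H] f].

(* Main.v *)
(* For infinite L, a group H in LV of cardinality at most L carries an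
   enumeration h : L -> H and a monotone rank f on the finite lists in L such
   that the elements of h s generate a member of V_(f s). There are too many
   ranks for one generator per pair (x, f), so order L with all proper initial
   segments smaller than L: since L = L^{<L}, the restriction of f to lists with
   maximum x can be coded by an element c x f of L. Take generators indexed by
   pairs (x, d) and let (h, f) send (x, d) to h x if d = c x f, and to 1
   otherwise. The universal group is the free group modulo the intersection of
   the kernels of all these evaluations. Every H is an image of it. It is in LV:
   given finitely many generators, those not killed by (h, f) have a maximal
   first coordinate x, whose code d determines the rank of the whole list, so
   finitely many ranks occur. For finite L, L = L^{<L} forces L <= 2. *)

Require Import Defs.
From HB Require Import structures.
From mathcomp Require Import all_boot.
From mathcomp Require Import boolp classical_sets functions cardinality wochoice.

Set Implicit Arguments.
Unset Strict Implicit.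
Unset Printing Implicit Defensive.

Local Open Scope classical_set_scope.
Local Open Scope card_scope.
Local Open Scope group_scope.
Local Open Scope quotient_scope.

(** * Cardinals *)

Lemma card_leT_inj (T U : Type) :
  ([set: T] #<= [set: U]) <-> exists f : T -> U, injective f.
Proof.
split=> [/card_leP/unsquash f|[f f_inj]].
  have f_inj : {in [set: [set: T]] &, injective f} by apply: inj.
  exists (fun x => val (f (SigSub (mem_set (I : [set: T] x))))) => x y /val_inj.
  by move=> /f_inj; rewrite !in_setT => /(_ isT isT)/(congr1 val).
rewrite -(card_le_eql (inj_card_eq (in2W f_inj : {in [set: T] &, injective f}))).
exact: card_leT.
Qed.

Lemma inj_card_lt (A B L : Type) (f : A -> B) :
  injective f -> card_lt B L -> card_lt A L.
Proof.
move=> f_inj [BL LB]; have AB : [set: A] #<= [set: B].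
  by apply/card_leT_inj; exists f.
split; first exact: card_le_trans AB BL.
by move=> LA; apply: LB; apply: card_le_trans LA AB.
Qed.

(** Transitivity comes from the least element of [{x, y, z}]: it is [x], or antisymmetry identifies
    [x] with [y] or [y] with [z]. *)
Lemma well_order_total_order (T : eqType) (R : rel T) :
  well_order R -> [/\ antisymmetric R, transitive R & total R].
Proof.
move=> R_wo; have R_chain : wo_chain R T := withinW R_wo.
have R_anti : antisymmetric R := in2T (wo_chain_antisymmetric R_chain).
split=> // [y x z Rxy Ryz|]; last exact: in2T (wo_chainW R_chain).
have [|m [[m_in m_min] _]] := R_wo [pred t | t \in [:: x; y; z]].
  by exists x; rewrite !inE eqxx.
have mx : R m x by apply: m_min; rewrite !inE eqxx.
have my : R m y by apply: m_min; rewrite !inE eqxx orbT.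
have mz : R m z by apply: m_min; rewrite !inE eqxx !orbT.
move: m_in; rewrite !inE => /or3P[] /eqP me; subst m => //.
  by rewrite (R_anti x y) // Rxy.
by rewrite -(R_anti y z) // Ryz.
Qed.

(** In a well-order, let [m] be the least element whose segment is not smaller than [L], if there is
    one. Then [L] embeds in the segment below [m], and the order pulled back along this embedding
    has its segments embedded in those of elements preceding [m]. *)
Lemma initial_order (L : eqType) :
  exists lt : rel L, [/\ transitive lt, forall x y, x != y -> lt x y || lt y x
    & forall x, card_lt {y | lt y x} L].
Proof.
have [R R_wo] := well_ordering_principle L.
have [R_anti R_trans R_total] := well_order_total_order R_wo.
pose S x y := R x y && (x != y).
have [i i_inj i_seg] : exists2 i : L -> L, injective i &
    forall x, card_lt {y | S y (i x)} L.
  have [all_small|/existsNP[a a_big]] := pselect (forall x, card_lt {y | S y x} L).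
    by exists id.
  have [|m [[m_big m_min] _]] := R_wo [pred x | `[< ~ card_lt {y | S y x} L >]].
    by exists a; apply/asboolP.
  have /card_leT_inj[j j_inj] : [set: L] #<= [set: {y | S y m}].
    apply: contrapT => nle; move/asboolP: m_big; apply; split=> //.
    by apply/card_leT_inj; exists val; apply: val_inj.
  exists (val \o j); first exact: inj_comp val_inj j_inj.
  move=> x /=; apply: contrapT => x_big.
  have Rm : R m (val (j x)) by apply: m_min; apply/asboolP.
  have /andP[Rx /negP[]] := valP (j x).
  by apply/eqP/R_anti; rewrite Rx.
exists (fun x y => S (i x) (i y)); split.
- move=> y x z /andP[xy nxy] /andP[yz nyz]; rewrite /S (R_trans _ _ _ xy yz) /=.
  by apply: contra nxy => /eqP exz; apply/eqP/R_anti; rewrite xy exz yz.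
- move=> x y nxy; rewrite /S (inj_eq i_inj) nxy (inj_eq i_inj) eq_sym nxy !andbT.
  exact: R_total.
- move=> x.
  apply: (@inj_card_lt _ {y | S y (i x)} _
    (fun y => exist _ (i (val y)) (valP y))) => //.
  by move=> y z /(congr1 val)/= /i_inj yz; apply: val_inj.
Qed.

Lemma max_elt (L : eqType) (lt : rel L) (s : seq L) :
  transitive lt -> (forall x y, x != y -> lt x y || lt y x) -> s != [::] ->
  exists2 x, x \in s & {in s, forall y, y != x -> lt y x}.
Proof.
move=> lt_trans lt_tri; elim: s => // a [|b s] IH _.
  by exists a => [|y]; rewrite inE // => /eqP->; rewrite eqxx.
have [//|x xs x_max] := IH.
have [->|nax] := eqVneq a x.
  exists x; first exact: mem_head.
  by move=> y; rewrite inE => /orP[/eqP->|/x_max//]; rewrite eqxx.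
have /orP[ax|xa] := lt_tri _ _ nax.
  exists x; first by rewrite inE xs orbT.
  by move=> y; rewrite inE => /orP[/eqP->|/x_max].
exists a; first exact: mem_head.
move=> y; rewrite inE => /orP[/eqP->|ys nya]; first by rewrite eqxx.
by have [->//|nyx] := eqVneq y x; apply: lt_trans xa; apply: x_max.
Qed.

Section InfiniteCardinal.
Variable L : eqType.
Hypothesis L_pow : forall M : cardinal, card_lt M L -> [set: M -> L] #<= [set: L].
Hypothesis L_inf : infinite_set [set: L].

Lemma inj_nat : exists q : nat -> L, injective q.
Proof. by apply/card_leT_inj/infiniteP. Qed.

Lemma fin_card_lt (M : finType) : card_lt M L.
Proof.
split; last by move=> LM; apply: L_inf; apply: card_le_finite LM _.
have [q q_inj] := inj_nat; apply/card_leT_inj.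
by exists (fun m => q (enum_rank m)) => m m' /q_inj/ord_inj/enum_rank_inj.
Qed.

Lemma inj_pair : exists p : L * L -> L, injective p.
Proof.
have /card_leT_inj[J J_inj] := L_pow (fin_card_lt bool).
exists (fun u => J (fun b => if b then u.1 else u.2)) => u v /J_inj uv.
case: u v uv => [u1 u2] [v1 v2] uv; congr pair.
  by move/(congr1 (@^~ true)): uv.
by move/(congr1 (@^~ false)): uv.
Qed.

Lemma inj_seq : exists p : seq L -> L, injective p.
Proof.
have [q q_inj] := inj_nat; have [p p_inj] := inj_pair.
(* The end value [q 0] is arbitrary: the length, stored separately, tells where decoding stops. *)
pose g := foldr (fun x y => p (x, y)) (q 0).
exists (fun s => p (q (size s), g s)) => s t /p_inj[/q_inj].
elim: s t => [|x s IH] [|y t] //=.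
by move=> [/IH st] /p_inj[-> /st->].
Qed.

(* Coding proceeds by induction on the length of the argument, so that only
   exponents below [L] occur, whereas [seq M] may fail to be below [L]. *)
Lemma inj_fun_seq (M : cardinal) : card_lt M L -> [set: nat] #<= [set: M] ->
  exists J : (seq M -> nat) -> L, injective J.
Proof.
move=> ML natM; have [q q_inj] := inj_nat.
have /card_leT_inj[JM JM_inj] := L_pow ML.
have /card_leT_inj[i i_inj] := natM.
have /card_leT_inj[JN JN_inj] := L_pow (inj_card_lt i_inj ML).
pose fix g n (f : seq M -> nat) {struct n} : L :=
  if n is n'.+1 then JM (fun m => g n' (fun s => f (m :: s))) else q (f [::]).
have g_inj n f f' : g n f = g n f' -> forall s, size s = n -> f s = f' s.
  elim: n f f' => [|n IH] f f' /=; first by move=> /q_inj ff' [].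
  by move=> /JM_inj ff' [//|m s] [/(IH _ _ (congr1 (@^~ m) ff'))].
exists (fun f => JN (g ^~ f)) => f f' /JN_inj ff'; apply: funext => s.
exact: g_inj (congr1 (@^~ (size s)) ff') _ _.
Qed.

(* Over a finite segment below [x] there may be more functions on lists than
   elements of [L]; there [A x] consists of a single list enumerating the segment
   and [x]. *)
Lemma local_coding : exists (A : L -> set (seq L)) (c : L -> (seq L -> nat) -> L),
  (forall x f g, c x f = c x g -> {in A x, f =1 g}) /\
  (forall s : seq L, s != [::] -> exists2 x, x \in s & exists2 t, A x t & {subset s <= t}).
Proof.
have [lt [lt_trans lt_tri lt_seg]] := initial_order L.
have [q q_inj] := inj_nat.
suff /choice[Ac Ac_spec] : forall x, exists Ac : set (seq L) * ((seq L -> nat) -> L),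
    (forall f g, Ac.2 f = Ac.2 g -> {in Ac.1, f =1 g}) /\
    (forall s : seq L, x \in s -> {in s, forall y, y != x -> lt y x} ->
       exists2 t, Ac.1 t & {subset s <= t}).
  exists (fun x => (Ac x).1), (fun x => (Ac x).2); split=> [x|s s0].
    by case: (Ac_spec x).
  have [x xs x_max] := max_elt lt_trans lt_tri s0; exists x => //.
  exact: (Ac_spec x).2.
move=> x; have [seg_fin|seg_inf] := pselect (finite_set [set: {y | lt y x}]).
  have /finite_seqP[e e_spec] := seg_fin.
  exists ([set x :: map val e], fun f => q (f (x :: map val e))).
  split=> [f g /q_inj /= fg t|s xs s_lt] /=.
    by rewrite inE /= => ->.
  exists (x :: map val e) => // y ys; rewrite inE; case: eqVneq => //= nyx.
  have yx := s_lt _ ys nyx; apply/mapP; exists (exist _ y yx) => //.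
  by have : [set: {y | lt y x}] (exist _ y yx) by []; rewrite e_spec.
have [J J_inj] := inj_fun_seq (lt_seg x) (iffLR (infiniteP _) seg_inf).
exists ([set x :: map val s | s in [set: seq {y | lt y x}]],
        fun f => J (fun s => f (x :: map val s))).
split=> [f g /J_inj fg t|s xs s_lt] /=.
  by rewrite inE => -[s _ <-]; move/(congr1 (@^~ s)): fg.
(* The elements of [s] other than its maximum [x] form a list in the segment; putting [x] in front
   gives the covering list. *)
have : all (lt ^~ x) [seq y <- s | y != x].
  by apply/allP => y; rewrite mem_filter => /andP[nyx ys]; apply: s_lt.
move=> /all_sigP[u u_eq]; exists (x :: map val u); first by exists u.
by move=> y ys; rewrite -u_eq inE mem_filter ys andbT orbN.
Qed.

End InfiniteCardinal.

(** * Local laws and quotients of free groups *)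

Lemma morph_group1 (G H : groupType) (f : G -> H) :
  {morph f : x y / x * y} -> f 1 = 1.
Proof. by move=> fM; apply: (mulgI (f 1)); rewrite -fM !mulg1. Qed.

Lemma morph_groupV (G H : groupType) (f : G -> H) :
  {morph f : x y / x * y} -> {morph f : x / x^-1}.
Proof.
by move=> fM x; apply: (mulgI (f x)); rewrite -fM !mulgV (morph_group1 fM).
Qed.

Lemma geval_morph (G H : groupType) (f : G -> H) (e : nat -> G) t :
  {morph f : x y / x * y} -> f (geval e t) = geval (f \o e) t.
Proof.
move=> fM; elim: t => //= [|t IHt u IHu|t IHt]; first exact: morph_group1.
  by rewrite fM IHt IHu.
by rewrite morph_groupV // IHt.
Qed.

Lemma geval_one (G : groupType) t : geval (fun=> 1 : G) t = 1.
Proof. by elim: t => //= [t -> u ->|t ->]; rewrite ?mulg1 ?invg1. Qed.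

Lemma generated_gen (G : groupType) (s : seq G) : {subset s <= generated s}.
Proof. by move=> x sx; apply/asboolP => K _; apply. Qed.

Lemma generated_min (G : groupType) (s : seq G) (K : {pred G}) :
  group_closed K -> {subset s <= K} -> {subset generated s <= K}.
Proof. by move=> cK sK x /asboolP; apply. Qed.

Lemma generated_sub (G : groupType) (s t : seq G) :
  {subset s <= generated t} -> {subset generated s <= generated t}.
Proof. by apply: generated_min; exact: generated_group_closed. Qed.

Lemma generated_nil (G : groupType) (x : G) : x \in generated [::] -> x = 1.
Proof.
move=> x1; apply/eqP; apply: (generated_min (K := pred1 1)) x1 => //.
by split=> [|y z]; rewrite !inE // => /eqP-> /eqP->; rewrite mulgV.
Qed.

Lemma generated_morph (G H : groupType) (f : G -> H) (s : seq G) (t : seq H) :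
  {morph f : x y / x * y} -> (forall x, x \in s -> f x \in generated t) ->
  forall x, x \in generated s -> f x \in generated t.
Proof.
move=> fM fst; apply: (generated_min (K := [pred x | f x \in generated t])) => //.
have [cl1 clD] := generated_group_closed t.
split=> [|x y fx fy]; first by suff: f 1 \in generated t by []; rewrite morph_group1.
suff: f (x / y) \in generated t by [].
by rewrite fM morph_groupV //; apply: clD.
Qed.

(** Stated in the ambient group, so that subgroups generated by different lists can be compared
    without subtypes. *)
Definition local_laws (E : set identity) (G : groupType) (s : seq G) :=
  forall w, E w -> forall e : nat -> G, (forall i, e i \in generated s) ->
    geval e w.1 = geval e w.2.

Lemma local_lawsP (E : set identity) (G : groupType) (s : seq G) :
  (forall w, E w -> satisfies (fg_subgroup s) w) <-> local_laws E s.
Proof.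
have valM : {morph (val : fg_subgroup s -> G) : x y / x * y} by move=> x y; rewrite valM.
split=> sat w Ew e => [gen_e|].
  have := congr1 val (sat w Ew (fun i => exist _ (e i) (gen_e i) : fg_subgroup s)).
  by rewrite !(geval_morph _ _ valM).
apply: val_inj; rewrite !(geval_morph _ _ valM).
by apply: (sat w Ew) => i /=; apply: valP.
Qed.

Lemma local_laws_sub (E : set identity) (G : groupType) (s t : seq G) :
  {subset s <= generated t} -> local_laws E t -> local_laws E s.
Proof.
by move=> st Et w Ew e gen_e; apply: Et => // i; apply: generated_sub (gen_e i).
Qed.

Lemma local_laws_nil (E : set identity) (G : groupType) : local_laws E ([::] : seq G).
Proof.
move=> w _ e gen_e; have -> : e = fun=> 1 by apply: funext => i; apply: generated_nil.
by rewrite !geval_one.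
Qed.

Section WordEvaluation.
Variables (I : Type) (H : groupType) (phi : I -> H).

Definition weval (w : seq (I * bool)) : H :=
  \prod_(l <- w) (if l.2 then phi l.1 else (phi l.1)^-1).

Definition winv (w : seq (I * bool)) := rev [seq (l.1, ~~ l.2) | l <- w].

Lemma weval_cat u v : weval (u ++ v) = weval u * weval v.
Proof. exact: big_cat. Qed.

Lemma weval_inv w : weval (winv w) = (weval w)^-1.
Proof.
elim: w => [|[i b] w IH]; first by rewrite /weval !big_nil invg1.
rewrite /winv /= rev_cons -cats1 weval_cat IH /weval big_seq1 big_cons /= invgM.
by case: b; rewrite /= ?invgK.
Qed.

Lemma weval_letter i : weval [:: (i, true)] = phi i.
Proof. exact: big_seq1. Qed.

End WordEvaluation.

Lemma weval_generated (I : eqType) (H : groupType) (phi : I -> H) t w :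
  (forall l, l \in w -> phi l.1 \in generated t) -> weval phi w \in generated t.
Proof.
have cl := generated_group_closed t; elim: w => [|l w IH] gen_w.
  by rewrite /weval big_nil; case: cl.
rewrite -cat1s weval_cat; apply: (group_closedM cl).
 rewrite /weval big_seq1; case: ifP => _; last apply: (group_closedV cl);
  by apply: gen_w; rewrite mem_head.
by apply: IH => k kw; apply: gen_w; rewrite inE kw orbT.
Qed.

(* [assignment_quot Phi] is the free group on [I] modulo the intersection of the
   kernels of all evaluations [phi] satisfying [Phi]. *)
Section AssignmentQuotient.
Variables (I : choiceType) (Phi : forall H : groupType, (I -> H) -> Prop).

Definition word_eqv (u v : seq (I * bool)) :=
  `[< forall (H : groupType) (phi : I -> H), Phi phi -> weval phi u = weval phi v >].

Lemma word_eqv_refl : reflexive word_eqv.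
Proof. by move=> u; apply/asboolP. Qed.

Lemma word_eqv_sym : symmetric word_eqv.
Proof.
by move=> u v; apply/asboolP/asboolP => uv H phi Pphi; rewrite uv.
Qed.

Lemma word_eqv_trans : transitive word_eqv.
Proof.
by move=> v u w /asboolP uv /asboolP vw; apply/asboolP => H phi Pphi; rewrite uv ?vw.
Qed.

Canonical word_eqv_equiv := EquivRel word_eqv word_eqv_refl word_eqv_sym word_eqv_trans.

Definition assignment_quot := {eq_quot word_eqv}.
HB.instance Definition _ := Choice.on assignment_quot.

Definition wclass (w : seq (I * bool)) : assignment_quot := \pi_({eq_quot word_eqv}) w.
Definition wrepr (x : assignment_quot) : seq (I * bool) := repr (x : {eq_quot word_eqv}).

Definition qeval (H : groupType) (phi : I -> H) (x : assignment_quot) :=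
  weval phi (wrepr x).

Lemma wrepr_inj : injective wrepr.
Proof. exact: can_inj (@reprK _ _). Qed.

Lemma qeval_class (H : groupType) (phi : I -> H) w :
  Phi phi -> qeval phi (wclass w) = weval phi w.
Proof.
move=> Pphi; rewrite /qeval.
suff /eqmodP/asboolP-> : wrepr (wclass w) = w %[mod {eq_quot word_eqv}] by [].
by rewrite reprK.
Qed.

Lemma qeval_ext (x y : assignment_quot) :
  (forall (H : groupType) (phi : I -> H), Phi phi -> qeval phi x = qeval phi y) -> x = y.
Proof.
by move=> xy; rewrite -[x]reprK -[y]reprK; apply/eqmodP/asboolP.
Qed.

Definition qmul x y := wclass (wrepr x ++ wrepr y).
Definition qinv x := wclass (winv (wrepr x)).

Lemma qeval_mul (H : groupType) (phi : I -> H) x y :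
  Phi phi -> qeval phi (qmul x y) = qeval phi x * qeval phi y.
Proof. by move=> Pphi; rewrite qeval_class // weval_cat. Qed.

Lemma qeval_inv (H : groupType) (phi : I -> H) x :
  Phi phi -> qeval phi (qinv x) = (qeval phi x)^-1.
Proof. by move=> Pphi; rewrite qeval_class // weval_inv. Qed.

Lemma qeval_one (H : groupType) (phi : I -> H) :
  Phi phi -> qeval phi (wclass [::]) = 1.
Proof. by move=> Pphi; rewrite qeval_class // /weval big_nil. Qed.

Lemma qmulA : associative qmul.
Proof.
by move=> x y z; apply: qeval_ext => H phi Pphi; rewrite !qeval_mul // mulgA.
Qed.

Lemma qmul1g : left_id (wclass [::]) qmul.
Proof.
by move=> x; apply: qeval_ext => H phi Pphi; rewrite qeval_mul // qeval_one // mul1g.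
Qed.

Lemma qmulg1 : right_id (wclass [::]) qmul.
Proof.
by move=> x; apply: qeval_ext => H phi Pphi; rewrite qeval_mul // qeval_one // mulg1.
Qed.

Lemma qmulVg : left_inverse (wclass [::]) qinv qmul.
Proof.
move=> x; apply: qeval_ext => H phi Pphi.
by rewrite qeval_mul // qeval_inv // qeval_one // mulVg.
Qed.

Lemma qmulgV : right_inverse (wclass [::]) qinv qmul.
Proof.
move=> x; apply: qeval_ext => H phi Pphi.
by rewrite qeval_mul // qeval_inv // qeval_one // mulgV.
Qed.

HB.instance Definition _ :=
  isGroup.Build assignment_quot qmulA qmul1g qmulg1 qmulVg qmulgV.

Lemma qevalM (H : groupType) (phi : I -> H) :
  Phi phi -> {morph qeval phi : x y / x * y}.
Proof. by move=> Pphi x y; apply: qeval_mul. Qed.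

End AssignmentQuotient.

(** * The universal group *)

Section InfiniteCase.
Variables (V : nat -> group_class) (L : choiceType).
Hypothesis V_variety : forall n, is_variety (V n).
Hypothesis V_ascending : ascending V.
Hypothesis L_pow : forall M : cardinal, card_lt M L -> [set: M -> L] #<= [set: L].
Hypothesis L_inf : infinite_set [set: L].

Variables (A : L -> set (seq L)) (c : L -> (seq L -> nat) -> L).
Hypothesis c_determines : forall x f g, c x f = c x g -> {in A x, f =1 g}.
Hypothesis A_covers : forall s : seq L, s != [::] ->
  exists2 x, x \in s & exists2 t, A x t & {subset s <= t}.

(** * Ranks and their bounds on finite sets of generators *)

Lemma ascendingP m n (G : groupType) : m <= n -> V m G -> V n G.
Proof.
move=> /subnKC<-; elim: (n - m) => [|k IH]; first by rewrite addn0.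
by move=> /IH; rewrite addnS; apply: V_ascending.
Qed.

Lemma variety_fg_sub n (G : groupType) (s t : seq G) :
  {subset s <= generated t} -> V n (fg_subgroup t) -> V n (fg_subgroup s).
Proof.
have [E VE] := V_variety n => st /VE/local_lawsP Et; apply/VE/local_lawsP.
exact: local_laws_sub st Et.
Qed.

Lemma variety_fg_nil n (G : groupType) : V n (fg_subgroup ([::] : seq G)).
Proof.
have [E VE] := V_variety n; apply/VE/local_lawsP; exact: local_laws_nil.
Qed.

Definition monotone_rank (f : seq L -> nat) := forall s t, {subset s <= t} -> f s <= f t.

Definition compatible (f : seq L -> nat) (i : L * L) := c i.1 f == i.2.

Lemma compatible_bound (T : seq (L * L)) : exists n, forall f, monotone_rank f ->
  let S := [seq i <- T | compatible f i] in S != [::] -> f (map fst S) <= n.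
Proof.
suff /choice[N N_bound] : forall S : seq (L * L), exists n, forall f, monotone_rank f ->
    all (compatible f) S -> S != [::] -> f (map fst S) <= n.
  (* The compatible part of [T] depends on [f], but it is one of the finitely many sublists of
     [T]. *)
  exists (\max_(m : (size T).-tuple bool) N (mask m T)) => f f_mono S S0.
  have sz : size (map (compatible f) T) == size T by rewrite size_map.
  have S_mask : S = mask (Tuple sz) T by rewrite /S filter_mask.
  apply: leq_trans (N_bound S f f_mono (filter_all _ _) S0) _.
  by rewrite S_mask; apply: (leq_bigmax (Tuple sz)).
move=> S; have [->|S0] := eqVneq S [::]; first by exists 0.
have fS0 : map fst S != [::] by case: S S0.
have [x /mapP[i iS ->] [t At St]] := A_covers fS0.
(* If no function has code [i.2] at [i.1], then [S] is compatible with none and 0 will do. Otherwise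
   every compatible [f] agrees at [t] with one fixed [f0], and [f0 t] bounds its rank by
   monotonicity. *)
have [[f0 f0i]|nof] := pselect (exists f0, c i.1 f0 = i.2); last first.
  by exists 0 => f _ /allP/(_ i iS)/eqP fi; case: nof; exists f.
exists (f0 t) => f f_mono /allP/(_ i iS)/eqP fi _.
apply: leq_trans (f_mono _ _ St) _.
by rewrite (c_determines (etrans fi (esym f0i))) // inE.
Qed.

Definition assignment (H : groupType) (h : L -> H) (f : seq L -> nat) (i : L * L) : H :=
  if compatible f i then h i.1 else 1.

Definition ranked_assignment (H : groupType) (phi : L * L -> H) :=
  exists h f, [/\ monotone_rank f, forall s, V (f s) (fg_subgroup (map h s))
    & phi = assignment h f].

Definition universal_quot := assignment_quot ranked_assignment.

(** Each evaluation maps the elements of [s] into the subgroup generated by the images of the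
    compatible generators in [T]. One [n] puts all these subgroups in [V n], so the identities of
    [V n] hold after every evaluation. *)
Lemma universal_quot_locally : locally (union_class V) universal_quot.
Proof.
move=> s; pose T := flatten [seq map fst (wrepr x) | x <- s].
have [n n_bound] := compatible_bound T; exists n.
have [E VE] := V_variety n; apply/VE/local_lawsP => w Ew e gen_e.
apply: qeval_ext => H phi rphi; have [h [f [f_mono f_rank phiE]]] := rphi.
pose S := [seq i <- T | compatible f i].
have Vn : V n (fg_subgroup (map h (map fst S))).
  (* The bound [n] says nothing about empty [S], where the subgroup is trivial. *)
  have [->|S0] := eqVneq S [::]; first exact: variety_fg_nil.
  exact: ascendingP (n_bound f f_mono S0) (f_rank _).
rewrite !(geval_morph _ _ (qevalM rphi)).
move/VE/local_lawsP: Vn; apply=> // i /=.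
apply: (generated_morph (qevalM rphi) _ (gen_e i)) => x xs.
apply: weval_generated => l lx; rewrite phiE /assignment; case: ifP => [comp|_].
  apply: generated_gen; apply/map_f/map_f; rewrite mem_filter comp.
  apply/flattenP; exists (map fst (wrepr x)); first exact: map_f.
  exact: map_f.
by case: (generated_group_closed (map h (map fst S))).
Qed.

Lemma universal_quot_le : [set: universal_quot] #<= [set: L].
Proof.
have [p p_inj] := inj_pair L_pow L_inf; have [q q_inj] := inj_seq L_pow L_inf.
have [nt nt_inj] := inj_nat L_inf.
apply/card_leT_inj.
exists (fun x : universal_quot =>
  q [seq p (p l.1, nt (nat_of_bool l.2)) | l <- wrepr x]) => x y /q_inj xy.
apply: wrepr_inj; apply: inj_map xy => -[[i1 i2] b] [[j1 j2] b'] /=.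
by move=> /p_inj[/p_inj[-> ->] /nt_inj]; case: b b' => [] [].
Qed.

(** Distinct letters are separated by sending one element of [L] to [h0] and all others to 1. Every
    subgroup involved lies in the one generated by [h0], so a constant rank works for all these
    assignments. *)
Lemma universal_quot_ge (H : groupType) (h0 : H) :
  locally (union_class V) H -> h0 <> 1 -> [set: L] #<= [set: universal_quot].
Proof.
move=> VH h01; have [n Vn] := VH [:: h0].
pose f0 (_ : seq L) := n.
pose letter a := wclass ranked_assignment [:: ((a, c a f0), true)].
apply/card_leT_inj; exists letter => a b ab.
pose h x := if x == a then h0 else 1; pose phi := assignment h f0.
have rphi : ranked_assignment phi.
  exists h, f0; split=> // s; apply: variety_fg_sub Vn => _ /mapP[x _ ->].
  rewrite /h; case: ifP => _; last by case: (generated_group_closed [:: h0]).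
  by apply: generated_gen; rewrite mem_head.
have : qeval phi (letter a) = qeval phi (letter b) by rewrite ab.
rewrite !qeval_class // !weval_letter /phi /assignment /compatible !eqxx /h /= eqxx.
by case: eqVneq => [->|].
Qed.

Lemma universal_quot_epi (H : groupType) :
  card_bounded (locally (union_class V)) L H ->
  exists g : {multiplicative universal_quot -> H}, set_surj [set: universal_quot] [set: H] g.
Proof.
move=> [VH /card_leT_inj[j j_inj]].
(* A left inverse of [j], with value 1 outside the image of [j]. *)
pose h (x : L) : H :=
  if pselect (exists y, j y = x) is left ex then sval (cid ex) else 1.
have hj y : h (j y) = y.
  rewrite /h; case: pselect => [ex|[]]; last by exists y.
  exact: j_inj (svalP (cid ex)).
have rank_ex s : exists n, `[< V n (fg_subgroup (map h s)) >].
  by have [n Vn] := VH (map h s); exists n; apply/asboolP.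
(* Choosing the least rank makes [f] monotone: by closure under subgroups, a rank for [t] is also
   one for each [s] contained in [t]. *)
pose f s := ex_minn (rank_ex s).
have f_rank s : V (f s) (fg_subgroup (map h s)).
  by rewrite /f; case: ex_minnP => m /asboolP.
have f_mono : monotone_rank f.
  move=> s t st; rewrite {1}/f; case: ex_minnP => m _; apply; apply/asboolP.
  apply: variety_fg_sub (f_rank t) => _ /mapP[x xs ->].
  by apply: generated_gen; apply: map_f; apply: st.
have rphi : ranked_assignment (assignment h f) by exists h, f.
pose g_mixin := isMultiplicative.Build universal_quot H
  (qeval (assignment h f)) (qevalM rphi).
pose g : {multiplicative universal_quot -> H} :=
  HB.pack (qeval (assignment h f)) g_mixin.
(* The second coordinate is the code of [f], so this letter is not killed and goes to [h (j y)]. *)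
exists g => y _; exists (wclass ranked_assignment [:: ((j y, c (j y) f), true)]) => //.
by rewrite /= qeval_class // weval_letter /assignment /compatible eqxx hj.
Qed.

End InfiniteCase.

Lemma epi_universal_infinite (V : nat -> group_class) (L : cardinal) (H : groupType) (h : H) :
  (forall n, is_variety (V n)) -> ascending V ->
  (forall M : cardinal, card_lt M L -> [set: M -> L] #<= [set: L]) ->
  infinite_set [set: L] -> locally (union_class V) H -> h <> 1 ->
  exists G : groupType, epi_universal (locally (union_class V)) L G.
Proof.
move=> V_variety V_asc L_pow L_inf VH h1.
have [A [c [c_det A_cov]]] := local_coding (L := {classic L}) L_pow L_inf.
exists (universal_quot V c); split.
- exact: (universal_quot_locally V_variety V_asc c_det A_cov).
- apply/card_esym; rewrite card_eq_le; apply/andP; split.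
    exact: (universal_quot_ge (L := {classic L}) V_variety c VH h1).
  exact: (@universal_quot_le V {classic L} L_pow L_inf c).
- exact: (@universal_quot_epi V {classic L} V_variety c).
Qed.

(** * Finite cardinals and groups of order at most 2 *)

Lemma pow_finite_le_bool (L : cardinal) (x y : L) : x <> y ->
  (forall M : cardinal, card_lt M L -> [set: M -> L] #<= [set: L]) ->
  finite_set [set: L] -> [set: L] #<= [set: bool].
Proof.
move=> xy L_pow /finite_setP[n Ln]; apply: contrapT => nLb.
have LI : [set: L] #= [set: 'I_n] by apply: card_eq_trans Ln card_II.
have /andP[/card_leT_inj[k k_inj] /card_leT_inj[i i_inj]] :
  ([set: L] #<= [set: 'I_n]) && ([set: 'I_n] #<= [set: L]) by rewrite -card_eq_le.
(* If [L] had more than two elements, [bool] would be a smaller cardinal, giving [n ^ 2 <= n] and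
   hence [n <= 1], against [x <> y]. *)
have /card_leT_inj[J J_inj] : [set: bool -> L] #<= [set: L].
  apply: L_pow; split=> //; apply/card_leT_inj.
  by exists (fun b => if b then x else y) => -[] [] // e; case: xy; rewrite e.
have /leq_card : injective (fun u : {ffun bool -> 'I_n} => k (J (i \o u))).
  by move=> u v /k_inj/J_inj uv; apply/ffunP => b; apply/i_inj/(congr1 (@^~ b) uv).
rewrite card_ffun !card_ord card_bool => n2.
have n1 : n <= 1.
  rewrite leqNgt; apply/negP => n_gt1.
  by rewrite leqNgt -[ltnLHS]expn1 ltn_exp2l ?n_gt1 in n2.
apply/xy/k_inj/ord_inj; have := ltn_ord (k x); have := ltn_ord (k y).
by case: (n) n1 (k x) (k y) => [|[]] // _ [[]] // ? [[]].
Qed.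

Lemma two_elements (T : Type) (a b x : T) :
  [set: T] #<= [set: bool] -> a <> b -> x = a \/ x = b.
Proof.
move=> /card_leT_inj[k k_inj] ab.
have : k a <> k b by move=> /k_inj.
case ka: (k a); case kb: (k b) => // _; case kx: (k x).
- by left; apply: k_inj; rewrite kx.
- by right; apply: k_inj; rewrite kx.
- by right; apply: k_inj; rewrite kx.
- by left; apply: k_inj; rewrite kx.
Qed.

Lemma order2_square (G : groupType) (g : G) :
  [set: G] #<= [set: bool] -> g <> 1 -> g * g = 1.
Proof.
move=> Gb g1; have [//|gg] := two_elements (g * g) Gb (nesym g1).
by case: g1; apply: (mulgI g); rewrite mulg1.
Qed.

Lemma order2_surj (G H : groupType) (g : G) :
  [set: G] #<= [set: bool] -> [set: H] #<= [set: bool] -> g <> 1 ->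
  exists f : {multiplicative G -> H}, set_surj [set: G] [set: H] f.
Proof.
move=> Gb Hb g1.
(* The image of [g]: the nontrivial element of [H], or 1 when [H] is trivial. *)
have [h h_surj] : exists h : H, forall y, y = 1 \/ y = h.
  have [[h h1]|noh] := pselect (exists h : H, h <> 1).
    by exists h => y; apply: two_elements => //; apply: nesym.
  by exists 1 => y; left; apply: contrapT => y1; apply: noh; exists y.
have hh : h * h = 1.
  by have [->|h1] := pselect (h = 1); [rewrite mulg1|apply: order2_square].
pose f (x : G) := if x == 1 then 1 else h.
have fM : {morph f : x y / x * y}.
  move=> x y; rewrite /f; have [->|x1] := eqVneq x 1; first by rewrite !mul1g.
  have [->|y1] := eqVneq y 1; first by rewrite !mulg1 (negPf x1).
  have two z : z != 1 -> z = g.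
    by move/eqP => z1; have [] := two_elements z Gb (nesym g1).
  by rewrite (two x) // (two y) // order2_square // eqxx hh.
pose f_mixin := isMultiplicative.Build G H f fM.
pose F : {multiplicative G -> H} := HB.pack f f_mixin.
exists F => y _; have [->|->] := h_surj y.
  by exists 1 => //=; rewrite /f eqxx.
by exists g => //=; rewrite /f; case: eqP.
Qed.

(** The last two hypotheses are forced by the conclusion: a group of cardinality [L] is nonempty,
    and if [L] has two elements, it is itself a nontrivial member of the bounded class. *)
Theorem theorem3p4 (V : nat -> group_class) (L : cardinal)
    (V_variety : forall n, is_variety (V n))
    (V_ascending : ascending V)
    (L_pow : eq_pow_lt_self L)
    (L_nonempty : inhabited L)
    (LV_nontrivial : (exists x y : L, x <> y) ->
       exists H : groupType,
         card_bounded (locally (union_class V)) L H /\ exists h : H, h <> 1%g) :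
  exists G : groupType, epi_universal (locally (union_class V)) L G.
Proof.
case: L_pow => L_pow _; case: L_nonempty => x0.
have [[x [y xy]]|all_eq] := pselect (exists x y : L, x <> y); last first.
  have all0 (x y : L) : x = y by apply: contrapT => xy; apply: all_eq; exists x, y.
  pose G := assignment_quot (fun (H : groupType) (_ : nat -> H) => False).
  have G1 (x y : G) : x = y by apply: qeval_ext.
  exists G; split.
  - move=> s; exists 0; have [E VE] := V_variety 0.
    apply/VE/local_lawsP => w _ e _; exact: G1.
  - rewrite card_eq_le; apply/andP; split; apply/card_leT_inj.
      by exists (fun=> x0) => a b _; apply: G1.
    by exists (fun=> 1) => a b _; apply: all0.
  - move=> H [_ /card_leT_inj[j j_inj]].
    have fM : {morph (fun _ : G => 1 : H) : x y / x * y} by move=> *; rewrite mulg1.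
    pose f_mixin := isMultiplicative.Build G H (fun=> 1) fM.
    pose f : {multiplicative G -> H} := HB.pack (fun _ : G => 1 : H) f_mixin.
    exists f => y _; exists 1 => //=; apply: j_inj; exact: all0.
have [H [[VH HL] [h h1]]] := LV_nontrivial (ex_intro _ x (ex_intro _ y xy)).
have [L_fin|L_inf] := pselect (finite_set [set: L]); last first.
  exact: epi_universal_infinite V_variety V_ascending L_pow L_inf VH h1.
have Lb := pow_finite_le_bool xy L_pow L_fin.
have Hb : [set: H] #<= [set: bool] by apply: card_le_trans HL Lb.
(* Here [L] has exactly two elements, so the nontrivial [H] has order 2 and maps onto every group of
   order at most 2. *)
exists H; split=> // [|K [_ KL]]; last first.
  by apply: order2_surj h1 => //; apply: card_le_trans KL Lb.
rewrite card_eq_le HL /=; apply: card_le_trans Lb _; apply/card_leT_inj.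
by exists (fun b : bool => if b then 1 else h) => -[] [] // e; case: h1; rewrite e.
Qed.
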